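(* Let $B$ be a left $n$-Hopf algebra over a field $\Bbbk$ with left $n$-antipode $S$, for some $n\in\mathbb{N}$ (e.g., $B$ is a finite-dimensional bialgebra). Then: (a) For all $y\in B$ we have $S(y)\oslash 1=1\oslash y$, whence $i_B\colon B\to B\oslash B$ is surjective. (b) For all $\sum_i x^i\otimes y_i\in (B\otimes B)^{\mathrm{co}B}$ we have $\sum_i S(x^i)\varepsilon(y_i)=\sum_i\varepsilon(x^i)y_i$, whence $p_B\colon (B\otimes B)^{\mathrm{co}B}\to B$ is injective.
   Context: For a bialgebra $B$, $f^{*k}$ denotes the $k$-th convolution power in $\mathrm{End}_\Bbbk(B)$ (with $f^{*0}=u\circ\varepsilon$, $u$ the unit and $\varepsilon$ the counit). A left $n$-Hopf algebra is a bialgebra $B$ such that $n\in\mathbb{N}$ is minimal with the property that there is $S\in\mathrm{End}_\Bbbk(B)$ with $S*\mathrm{Id}^{*(n+1)}=\mathrm{Id}^{*n}$; such an $S$ is called a left $n$-antipode. Put $B^+=\ker(\varepsilon)$, $B\oslash B:=(B\otimes B)/\big((B\otimes B)\Delta(B^+)\big)$, $x\oslash y$ the class of $x\otimes y$, $i_B\colon B\to B\oslash B$, $b\mapsto b\oslash 1$. Put $(B\otimes B)^{\mathrm{co}B}:=\{\sum_i x^i\otimes y_i\in B\otimes B \mid \sum_i x^i_1\otimes (y_i)_1\otimes x^i_2(y_i)_2=\sum_i x^i\otimes y_i\otimes 1\}$ and $p_B\colon (B\otimes B)^{\mathrm{co}B}\to B$, $\sum_i x^i\otimes y_i\mapsto\sum_i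 x^i\varepsilon(y_i)$. The parenthetical means that every finite-dimensional bialgebra is a left $n$-Hopf algebra for some $n\in\mathbb{N}$. *)

(* Defs.v *)
From HB Require Import structures.
From mathcomp Require Import all_boot all_algebra.
From mathcomp Require Import boolp.
From mathcomp Require Import freeg.

Set Implicit Arguments.
Unset Strict Implicit.
Unset Printing Implicit Defensive.

Import GRing.Theory.
Local Open Scope ring_scope.
Local Open Scope quotient_scope.

Reserved Notation "x ⊗ y" (at level 40, left associativity).
Reserved Notation "x ⊘ y" (at level 40, left associativity).

(* The quotient of a module V by the submodule generated by a set G of vectors. *)
Section LinearSpan.
Variables (k : fieldType) (V : lmodType k) (G : V -> Prop).

Definition lspan : {pred V} := fun v =>
  `[< exists2 s : seq (k * V),
        (forall p, p \in s -> G p.2) & v = \sum_(p <- s) p.1 *: p.2 >].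

Lemma lspan_submod_closed : submod_closed lspan.
Proof.
split=> [|a u v /asboolP[s sG ->] /asboolP[t tG ->]]; apply/asboolP.
  by exists [::] => //; rewrite big_nil.
exists ([seq (a * p.1, p.2) | p <- s] ++ t) => [p|].
  by rewrite mem_cat => /orP[/mapP[q /sG Gq ->] //|/tG].
rewrite big_cat big_map scaler_sumr; congr (_ + _).
by apply: eq_bigr => p _; rewrite scalerA.
Qed.

HB.instance Definition _ := GRing.isSubmodClosed.Build k V lspan
  lspan_submod_closed.

Lemma lspan_gen v : G v -> v \in lspan.
Proof.
move=> Gv; apply/asboolP; exists [:: (1, v)]; first by move=> p /[1!inE]/eqP->.
by rewrite big_seq1 scale1r.
Qed.

Definition lquot := Quotient.quot lspan.

HB.instance Definition _ := GRing.Zmodule.on lquot.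
HB.instance Definition _ := EqQuotient.on lquot.

Definition lquot_pi (v : V) : lquot := \pi_lquot v.

Lemma lquot_piP u v : lquot_pi u = lquot_pi v <-> u - v \in lspan.
Proof. by rewrite Quotient.idealrBE; split=> /eqP. Qed.

Lemma lquot_piD : {morph lquot_pi : u v / u + v}.
Proof. exact: (@Quotient.pi_add V lspan). Qed.

Definition lquot_scale (a : k) (x : lquot) : lquot := lquot_pi (a *: repr x).

Lemma lquot_scale_pi a v : lquot_scale a (lquot_pi v) = lquot_pi (a *: v).
Proof.
apply/lquot_piP; rewrite -scalerBr rpredZ //; apply/lquot_piP.
by rewrite /lquot_pi reprK.
Qed.

Lemma lquot_piE (x : lquot) : exists v, x = lquot_pi v.
Proof. by exists (repr x); rewrite /lquot_pi reprK. Qed.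

Fact lquot_scaleA a b x : lquot_scale a (lquot_scale b x) = lquot_scale (a * b) x.
Proof. by case: (lquot_piE x) => v ->; rewrite !lquot_scale_pi scalerA. Qed.
Fact lquot_scale1 : left_id 1 lquot_scale.
Proof. by move=> x; case: (lquot_piE x) => v ->; rewrite lquot_scale_pi scale1r. Qed.
Fact lquot_scaleDr : right_distributive lquot_scale +%R.
Proof.
move=> a x y; case: (lquot_piE x) (lquot_piE y) => u -> [v ->].
by rewrite -lquot_piD !lquot_scale_pi scalerDr lquot_piD.
Qed.
Fact lquot_scaleDl x : {morph lquot_scale^~ x : a b / a + b}.
Proof.
move=> a b; case: (lquot_piE x) => v ->.
by rewrite !lquot_scale_pi scalerDl lquot_piD.
Qed.

HB.instance Definition _ := GRing.Zmodule_isLmodule.Build k lquot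
  lquot_scaleA lquot_scale1 lquot_scaleDr lquot_scaleDl.

Fact lquot_pi_is_linear : linear lquot_pi.
Proof. by move=> a u v; rewrite lquot_piD -lquot_scale_pi. Qed.
HB.instance Definition _ := GRing.isLinear.Build k V lquot *:%R lquot_pi
  lquot_pi_is_linear.

Section Lift.
Variables (W : lmodType k) (f : {linear V -> W}) (fG : forall v, G v -> f v = 0).

Definition lquot_lift of (forall v, G v -> f v = 0) := fun x : lquot => f (repr x).

Lemma lquot_lift_pi v : lquot_lift fG (lquot_pi v) = f v.
Proof.
apply/eqP; rewrite -subr_eq0 -linearB; apply/eqP.
suff /asboolP[s sG ->]: repr (lquot_pi v) - v \in lspan.
  rewrite linear_sum big_seq big1 // => p /sG /fG fp0.
  by rewrite linearZ /= fp0 scaler0.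
by apply/lquot_piP; rewrite /lquot_pi reprK.
Qed.

Fact lquot_lift_is_linear : linear (lquot_lift fG).
Proof.
move=> a x y; case: (lquot_piE x) (lquot_piE y) => u -> [v ->].
by rewrite -linearP !lquot_lift_pi linearP.
Qed.
HB.instance Definition _ := GRing.isLinear.Build k lquot W *:%R (lquot_lift fG)
  lquot_lift_is_linear.
End Lift.

End LinearSpan.

Definition bilinear_map (k : fieldType) (V W U : lmodType k) (f : V -> W -> U) :=
  (forall y, linear (f^~ y)) /\ (forall x, linear (f x)).

Section Tensor.
Variables (k : fieldType) (V W : lmodType k).

Local Notation free := {freeg (V * W) / k}.
Local Notation gen x y := (<< (x, y) >> : free).

Inductive tensor_rel : free -> Prop :=
| TensorDl x x' y : tensor_rel (gen (x + x') y - gen x y - gen x' y)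
| TensorDr x y y' : tensor_rel (gen x (y + y') - gen x y - gen x y')
| TensorZl a x y : tensor_rel (gen (a *: x) y - a *: gen x y)
| TensorZr a x y : tensor_rel (gen x (a *: y) - a *: gen x y).

Definition tensor := lquot tensor_rel.
HB.instance Definition _ := GRing.Lmodule.on tensor.

Definition tpure (x : V) (y : W) : tensor := lquot_pi tensor_rel (gen x y).
Local Notation "x ⊗ y" := (tpure x y).

Lemma tensor_relE z : tensor_rel z -> lquot_pi tensor_rel z = 0.
Proof.
by move=> /lspan_gen z0; rewrite -(linear0 (lquot_pi tensor_rel));
  apply/lquot_piP; rewrite subr0.
Qed.

Fact tpureDl x x' y : (x + x') ⊗ y = x ⊗ y + x' ⊗ y.
Proof.
have := tensor_relE (TensorDl x x' y); rewrite !linearB /= -addrA -opprD.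
by move/eqP; rewrite subr_eq0 => /eqP.
Qed.
Fact tpureDr x y y' : x ⊗ (y + y') = x ⊗ y + x ⊗ y'.
Proof.
have := tensor_relE (TensorDr x y y'); rewrite !linearB /= -addrA -opprD.
by move/eqP; rewrite subr_eq0 => /eqP.
Qed.
Fact tpureZl a x y : (a *: x) ⊗ y = a *: (x ⊗ y).
Proof.
have := tensor_relE (TensorZl a x y); rewrite linearB linearZ /=.
by move/eqP; rewrite subr_eq0 => /eqP.
Qed.
Fact tpureZr a x y : x ⊗ (a *: y) = a *: (x ⊗ y).
Proof.
have := tensor_relE (TensorZr a x y); rewrite linearB linearZ /=.
by move/eqP; rewrite subr_eq0 => /eqP.
Qed.

Fact tpure_is_bilinear : bilinear_map tpure.
Proof.
split=> [y|x] a u v /=; first by rewrite tpureDl tpureZl.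
by rewrite tpureDr tpureZr.
Qed.
HB.instance Definition _ x := GRing.isLinear.Build k W tensor *:%R (tpure x)
  (tpure_is_bilinear.2 x).

Definition tpurer (y : W) (x : V) : tensor := x ⊗ y.
HB.instance Definition _ y := GRing.isLinear.Build k V tensor *:%R (tpurer y)
  (tpure_is_bilinear.1 y).

Lemma tpurePl a x x' y : (a *: x + x') ⊗ y = a *: (x ⊗ y) + x' ⊗ y.
Proof. exact: (tpure_is_bilinear.1 y). Qed.
Lemma tpurePr a x y y' : x ⊗ (a *: y + y') = a *: (x ⊗ y) + x ⊗ y'.
Proof. exact: (tpure_is_bilinear.2 x). Qed.

Lemma tensorE (t : tensor) :
  exists s : seq (V * W), t = \sum_(p <- s) p.1 ⊗ p.2.
Proof.
case: (lquot_piE t) => z ->; rewrite -(freeg_sumE z) linear_sum /=.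
exists [seq (coeff p z *: p.1, p.2) | p <- dom z].
rewrite [RHS]big_map; apply: eq_bigr => -[x y] _ /=.
rewrite tpureZl /tpure -linearZ /=; congr lquot_pi.
by apply/eqP/freeg_eqP => q; rewrite coeffZ !coeffU mul1r.
Qed.

Section Lift.
Variables (U : lmodType k) (f : V -> W -> U) (fB : bilinear_map f).

Definition free_lift : free -> U := fglift (fun p : V * W => f p.1 p.2).
Fact free_lift_is_linear : linear free_lift.
Proof.
pose g := fun p : V * W => f p.1 p.2.
have B z t : fglift g (z - t) = fglift g z - fglift g t.
  exact: (@lift_is_additive k (V * W)%type U g z t).
have N t : fglift g (- t) = - fglift g t.
  by rewrite -[- t]add0r B -[0 in LHS](subrr t) B subrr add0r.
have D z t : fglift g (z + t) = fglift g z + fglift g t.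
  by rewrite -{1}[t]opprK B N opprK.
have S (I : Type) (r : seq I) F :
    fglift g (\sum_(i <- r) F i) = \sum_(i <- r) fglift g (F i).
  elim: r => [|i r IHr]; last by rewrite !big_cons D IHr.
  by rewrite !big_nil -(subrr 0) B subrr.
move=> a z t; rewrite /free_lift D; congr (_ + _).
rewrite -{1 2}(freeg_sumE z) scaler_sumr !S scaler_sumr.
apply: eq_bigr => p _; rewrite liftU scalerA -(liftU g (a * _) p); congr fglift.
by apply/eqP/freeg_eqP => q; rewrite coeffZ !coeffU mulrA.
Qed.
HB.instance Definition _ := GRing.isLinear.Build k free U *:%R free_lift
  free_lift_is_linear.

Fact bilinear0l y : f 0 y = 0.
Proof.
by rewrite -(addNr (0 : V)) -[X in f X y]/(- 0 + 0) -scaleN1r (fB.1 y) scaleN1r addNr.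
Qed.
Fact bilinear0r x : f x 0 = 0.
Proof.
by rewrite -(addNr (0 : W)) -[X in f x X]/(- 0 + 0) -scaleN1r (fB.2 x) scaleN1r addNr.
Qed.

Lemma free_lift_rel z : tensor_rel z -> free_lift z = 0.
Proof.
have E x y : free_lift (gen x y) = f x y by rewrite /free_lift liftU scale1r.
case=> [x x' y|x y y'|a x y|a x y]; rewrite !linearB /= ?linearZ /= !E.
- by rewrite -[x]scale1r (fB.1 y) !scale1r -addrA -opprD subrr.
- by rewrite -[y]scale1r (fB.2 x) !scale1r -addrA -opprD subrr.
- by rewrite -[a *: x]addr0 (fB.1 y) bilinear0l addr0 scalerN subrr.
- by rewrite -[a *: y]addr0 (fB.2 x) bilinear0r addr0 scalerN subrr.
Qed.

Definition tlift : tensor -> U := lquot_lift free_lift_rel.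
HB.instance Definition _ := GRing.Linear.on tlift.

Lemma tliftE x y : tlift (x ⊗ y) = f x y.
Proof. by rewrite /tlift lquot_lift_pi /= /free_lift liftU scale1r. Qed.
End Lift.

Lemma tensor_ext (U : lmodType k) (f g : {linear tensor -> U}) :
  (forall x y, f (x ⊗ y) = g (x ⊗ y)) -> f =1 g.
Proof.
move=> fg t; case: (tensorE t) => s ->; rewrite !linear_sum.
by apply: eq_bigr => p _; apply: fg.
Qed.

End Tensor.

Notation "x ⊗ y" := (tpure x y) : ring_scope.

Section TensorMaps.
Variable k : fieldType.
Implicit Types U V W : lmodType k.

Section Map.
Variables (V V' W W' : lmodType k) (f : {linear V -> V'}) (g : {linear W -> W'}).

Definition tmap_fun (x : V) (y : W) : tensor V' W' := f x ⊗ g y.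
Fact tmap_fun_is_bilinear : bilinear_map tmap_fun.
Proof.
by split=> [y|x] a u v; rewrite /tmap_fun linearP (tpurePl, tpurePr).
Qed.

Definition tmap : tensor V W -> tensor V' W' := tlift tmap_fun_is_bilinear.
HB.instance Definition _ := GRing.Linear.on tmap.

Lemma tmapE x y : tmap (x ⊗ y) = f x ⊗ g y. Proof. exact: tliftE. Qed.
End Map.

(* The contractions f ⊗ id : V ⊗ W -> W and id ⊗ g : V ⊗ W -> V. *)
Section Contract.
Variables (V W : lmodType k) (f : {linear V -> k^o}) (g : {linear W -> k^o}).

Definition tcontractl_fun (x : V) (y : W) : W := (f x : k) *: y.
Fact tcontractl_fun_is_bilinear : bilinear_map tcontractl_fun.
Proof.
split=> [y|x] a u v; rewrite /tcontractl_fun.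
  by rewrite linearP /= scalerDl -[X in X *: y + _]/(a * f u) -scalerA.
by rewrite scalerDr scalerA mulrC -scalerA.
Qed.
Definition tcontractl : tensor V W -> W := tlift tcontractl_fun_is_bilinear.
HB.instance Definition _ := GRing.Linear.on tcontractl.
Lemma tcontractlE x y : tcontractl (x ⊗ y) = (f x : k) *: y.
Proof. exact: tliftE. Qed.

Definition tcontractr_fun (x : V) (y : W) : V := (g y : k) *: x.
Fact tcontractr_fun_is_bilinear : bilinear_map tcontractr_fun.
Proof.
split=> [y|x] a u v; rewrite /tcontractr_fun.
  by rewrite scalerDr scalerA mulrC -scalerA.
by rewrite linearP /= scalerDl -[X in X *: x + _]/(a * g u) -scalerA.
Qed.
Definition tcontractr : tensor V W -> V := tlift tcontractr_fun_is_bilinear.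
HB.instance Definition _ := GRing.Linear.on tcontractr.
Lemma tcontractrE x y : tcontractr (x ⊗ y) = (g y : k) *: x.
Proof. exact: tliftE. Qed.
End Contract.

(* (u ⊗ v) ⊗ w |-> u ⊗ (v ⊗ w) *)
Section Assoc.
Variables U V W : lmodType k.

Definition tassoc_fun (t : tensor U V) (w : W) : tensor U (tensor V W) :=
  tmap idfun (tpurer w) t.
Fact tassoc_fun_is_bilinear : bilinear_map tassoc_fun.
Proof.
split=> [w|t] a u v; rewrite /tassoc_fun ?linearP //.
case: (tensorE t) => s ->; rewrite !linear_sum -big_split /=.
by apply: eq_bigr => p _; rewrite !tmapE /= /tpurer !tpurePr.
Qed.
Definition tassoc : tensor (tensor U V) W -> tensor U (tensor V W) :=
  tlift tassoc_fun_is_bilinear.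
HB.instance Definition _ := GRing.Linear.on tassoc.
Lemma tassocE x y z : tassoc (x ⊗ y ⊗ z) = x ⊗ (y ⊗ z).
Proof. by rewrite /tassoc tliftE /= /tassoc_fun tmapE. Qed.
End Assoc.

(* (a ⊗ b) ⊗ (c ⊗ d) |-> (a ⊗ c) ⊗ (b ⊗ d) *)
Section Exchange.
Variables A B C D : lmodType k.
Local Notation T := (tensor (tensor A C) (tensor B D)).

Definition tinterchange_pure (u : tensor C D) (a : A) (b : B) : T :=
  tmap (tpure a) (tpure b) u.
Fact tinterchange_pure_is_bilinear u : bilinear_map (tinterchange_pure u).
Proof.
case: (tensorE u) => s ->.
split=> [b|a] z x y; rewrite /tinterchange_pure !linear_sum -big_split /=;
  by apply: eq_bigr => p _; rewrite !tmapE /= !(tpurePl, tpurePr).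
Qed.

Definition tinterchange_fun (t : tensor A B) (u : tensor C D) : T :=
  tlift (tinterchange_pure_is_bilinear u) t.
Fact tinterchange_fun_is_bilinear : bilinear_map tinterchange_fun.
Proof.
split=> [u|t] a x y; rewrite /tinterchange_fun ?linearP //.
case: (tensorE t) => s ->; rewrite !linear_sum -big_split /=.
by apply: eq_bigr => p _; rewrite !tliftE /= /tinterchange_pure linearP.
Qed.

Definition tinterchange : tensor (tensor A B) (tensor C D) -> T :=
  tlift tinterchange_fun_is_bilinear.
HB.instance Definition _ := GRing.Linear.on tinterchange.
Lemma tinterchangeE a b c d : tinterchange ((a ⊗ b) ⊗ (c ⊗ d)) = (a ⊗ c) ⊗ (b ⊗ d).
Proof.
rewrite /tinterchange !tliftE /= /tinterchange_fun tliftE /=.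
by rewrite /tinterchange_pure tmapE.
Qed.
End Exchange.

(* The multiplication of an algebra A, as a linear map A ⊗ A -> A. *)
Section Mul.
Variable A : algType k.

Definition amul_fun (x y : A) : A := x * y.
Fact amul_fun_is_bilinear : bilinear_map amul_fun.
Proof.
split=> [y|x] a u v; rewrite /amul_fun.
  by rewrite mulrDl scalerAl.
by rewrite mulrDr scalerAr.
Qed.
Definition amul : tensor A A -> A := tlift amul_fun_is_bilinear.
HB.instance Definition _ := GRing.Linear.on amul.
Lemma amulE x y : amul (x ⊗ y) = x * y. Proof. exact: tliftE. Qed.
End Mul.

End TensorMaps.

(* The algebra A ⊗ B, with (a ⊗ b) * (c ⊗ d) = (a * c) ⊗ (b * d). *)
Section TensorAlgebra.
Variables (k : fieldType) (A B : algType k).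
Implicit Types t u v : tensor A B.

Definition tmul t u : tensor A B := tmap (@amul k A) (@amul k B) (tinterchange (t ⊗ u)).

Lemma tmulE a b c d : tmul (a ⊗ b) (c ⊗ d) = (a * c) ⊗ (b * d).
Proof. by rewrite /tmul tinterchangeE tmapE /= !amulE. Qed.

Fact tmulDl : left_distributive tmul +%R.
Proof. by move=> t u v; rewrite /tmul -linearD -linearD -[t]scale1r tpurePl !scale1r. Qed.
Fact tmulDr : right_distributive tmul +%R.
Proof. by move=> t u v; rewrite /tmul -linearD -linearD -[u]scale1r tpurePr !scale1r. Qed.
Fact tmul0l t : tmul 0 t = 0.
Proof. by apply: (addrI (tmul 0 t)); rewrite -tmulDl !addr0. Qed.
Fact tmul0r t : tmul t 0 = 0.
Proof. by apply: (addrI (tmul t 0)); rewrite -tmulDr !addr0. Qed.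
Fact tmul_suml (I : Type) (s : seq I) F u :
  tmul (\sum_(i <- s) F i) u = \sum_(i <- s) tmul (F i) u.
Proof. by apply: (big_morph (tmul^~ u)) => [x y|]; rewrite ?tmulDl ?tmul0l. Qed.
Fact tmul_sumr (I : Type) (s : seq I) F t :
  tmul t (\sum_(i <- s) F i) = \sum_(i <- s) tmul t (F i).
Proof. by apply: (big_morph (tmul t)) => [x y|]; rewrite ?tmulDr ?tmul0r. Qed.

Fact tmulA : associative tmul.
Proof.
move=> t u v; case: (tensorE t) (tensorE u) (tensorE v) => r -> [s ->] [p ->].
rewrite !tmul_suml; apply: eq_bigr => i _.
rewrite !(tmul_sumr s) tmul_suml; apply: eq_bigr => j _.
by rewrite !(tmul_sumr p); apply: eq_bigr => l _; rewrite !tmulE !mulrA.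
Qed.
Fact tmul1l : left_id ((1 : A) ⊗ (1 : B)) tmul.
Proof.
move=> t; case: (tensorE t) => s ->; rewrite tmul_sumr.
by apply: eq_bigr => -[x y] _; rewrite tmulE !mul1r.
Qed.
Fact tmul1r : right_id ((1 : A) ⊗ (1 : B)) tmul.
Proof.
move=> t; case: (tensorE t) => s ->; rewrite tmul_suml.
by apply: eq_bigr => -[x y] _; rewrite tmulE !mulr1.
Qed.

HB.instance Definition _ := GRing.Zmodule_isPzRing.Build (tensor A B)
  tmulA tmul1l tmul1r tmulDl tmulDr.

Lemma tensor1E : 1 = 1 ⊗ 1 :> tensor A B. Proof. by []. Qed.
Lemma tensorME a b c d : (a ⊗ b) * (c ⊗ d) = (a * c) ⊗ (b * d) :> tensor A B.
Proof. exact: tmulE. Qed.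
End TensorAlgebra.

HB.mixin Record isCoalgebra (k : fieldType) C of GRing.Lmodule k C := {
  comul : {linear C -> tensor C C};
  counit : {linear C -> k^o};
  comulA : forall x, tassoc (tmap comul idfun (comul x)) = tmap idfun comul (comul x);
  counitl : forall x, tcontractl counit (comul x) = x;
  counitr : forall x, tcontractr counit (comul x) = x
}.

#[short(type="coalgType")]
HB.structure Definition Coalgebra (k : fieldType) :=
  {C of GRing.Lmodule k C & isCoalgebra k C}.

HB.mixin Record isBialgebra (k : fieldType) B of GRing.Algebra k B & Coalgebra k B := {
  comul_is_monoid_morphism : GRing.monoid_morphism (comul : B -> tensor B B);
  counit_is_monoid_morphism : GRing.monoid_morphism (counit : B -> k^o)
}.

#[short(type="bialgType")]
HB.structure Definition Bialgebra (k : fieldType) :=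
  {B of GRing.Algebra k B & Coalgebra k B & isBialgebra k B}.

Section Bialgebra.
Variables (k : fieldType) (B : bialgType k).
Implicit Types f g S : {linear B -> B}.

Definition conv f g : B -> B := @amul k B \o tmap f g \o comul.
HB.instance Definition _ f g := GRing.Linear.on (conv f g).

(* u ∘ ε, the unit of the convolution algebra End_k(B) *)
Definition conv1 : B -> B := fun x => (counit x : k)%:A.
Fact conv1_is_linear : linear conv1.
Proof. by move=> a x y; rewrite /conv1 linearP /= scalerDl -scalerA. Qed.
HB.instance Definition _ := GRing.isLinear.Build k B B *:%R conv1 conv1_is_linear.

Fixpoint convX f n : {linear B -> B} :=
  if n is m.+1 then conv f (convX f m) else conv1.

Definition left_antipode n S : Prop := conv S (convX idfun n.+1) =1 convX idfun n.

Definition left_Hopf n : Prop :=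
  (exists S, left_antipode n S) /\
  (forall m, (exists S, left_antipode m S) -> (n <= m)%N).

(* The generators t * Δ(b), with ε(b) = 0, of (B ⊗ B) Δ(B^+). *)
Definition oslash_rel (z : tensor B B) : Prop :=
  exists t b, counit b = 0 /\ z = t * comul b.

Definition oslash := lquot oslash_rel.
HB.instance Definition _ := GRing.Lmodule.on oslash.

Definition oslash_pure (x y : B) : oslash := lquot_pi oslash_rel (x ⊗ y).

Definition iB (b : B) : oslash := oslash_pure b 1.

(* x ⊗ y |-> (x_1 ⊗ y_1) ⊗ x_2 y_2 *)
Definition diag_coaction : tensor B B -> tensor (tensor B B) B :=
  tmap idfun (@amul k B) \o @tinterchange k B B B B \o tmap comul comul.
HB.instance Definition _ := GRing.Linear.on diag_coaction.

Definition coinv : {pred tensor B B} := fun t => diag_coaction t == t ⊗ 1.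

Definition coinv_sub := {t : tensor B B | t \in coinv}.

Definition pB (t : coinv_sub) : B := tcontractr counit (val t).

End Bialgebra.

Arguments left_Hopf {k} B n.
Arguments left_antipode {k B} n S.
Arguments iB {k B} b.
Arguments coinv {k} B.
Arguments pB {k B} t.

Notation "x ⊘ y" := (oslash_pure x y) : ring_scope.

Definition finite_dim (k : fieldType) (V : lmodType k) : Prop :=
  exists d (f : {linear V -> 'rV[k]_d}), bijective f.

(* Main.v *)
From HB Require Import structures.
Require Import Defs.
From mathcomp Require Import all_boot all_algebra.
From mathcomp Require Import boolp.
Import GRing.Theory.
Local Open Scope ring_scope.

Set Implicit Arguments.
Unset Strict Implicit.
Unset Printing Implicit Defensive.

(** Write [f * g] for convolution, [f(x_1) g(x_2)], and [f *' g] for convolution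
    in the opposite algebra, [g(x_2) f(x_1)].

    Both parts come from the same mechanism.  Consider an expression [P f g]
    depending on two linear endomorphisms of [B] in which multiplying [f] by
    [Id] on the right can be absorbed by an operation [shift] on [g]:
    [P (f * Id) (shift g) = P f g].  Iterating gives
    [P (f * Id^m) (shift^m g) = P f g], so a left [n]-antipode [S] satisfies
<<
      P S g = P (S * Id^(n+1)) (shift^(n+1) g)
            = P Id^n (shift^n (shift g))  =  P (u ε) (shift g)
>>
    ([pairing_left_antipode]).  Now take [g = u ε], and [shift] such that
    [shift (u ε) = Id].

    - For (a), [P f g] is the class of [x f(y_1) ⊗ g(y_2)] in [B ⊘ B], and
      [shift g = Id *' g].  Then [P (f * Id) (shift g)] is the class of
      [x f(y_1) y_2 ⊗ g(y_4) y_3 = (x f(y_1) ⊗ g(y_3)) Δ(y_2)], where [Δ(y_2)]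
      may be replaced by [ε(y_2)].  The conclusion is [x S(y) ⊘ 1 = x ⊘ y]:
      the case [x = 1] is the identity of (a), and the general case shows
      that [i_B] is surjective.

    - For (b), fix a coinvariant [t = x ⊗ y] (a sum being understood).  Here
      [P f g = x_1 ⊗ f(x_2) g(y)] and [shift g = g *' Id], so that
      [P (f * Id) (shift g) = x_1 ⊗ f(x_2) (x_3 y_2) g(y_1)], and coinvariance
      replaces [x_3 y_2] by [1].  The conclusion is [(id ⊗ S) Δ(p_B t) = t].
      Thus [p_B t] determines [t], and applying [ε ⊗ id] yields the identity
      of (b).

    When [B] is finite dimensional, the powers [Id^j] satisfy a nontrivial
    linear relation.  Solving it for the lowest power [Id^n] with a nonzero
    coefficient writes [Id^n] as [S * Id^(n+1)], with [S] a combination of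
    powers of [Id]. *)

(** * Linear maps on sums of pure tensors *)

Section TensorSums.
Variables (k : fieldType) (V W V' W' : lmodType k).

Lemma tpure_suml I (s : seq I) (F : I -> V) (y : W) :
  (\sum_(i <- s) F i) ⊗ y = \sum_(i <- s) F i ⊗ y.
Proof.
have tD : {morph (@tpure k V W)^~ y : x x' / x + x'} by move=> x x'; apply: tpureDl.
exact: (big_morph _ tD (bilinear0l (@tpure_is_bilinear k V W) y)).
Qed.

Lemma tpure_sumr I (s : seq I) (x : V) (F : I -> W) :
  x ⊗ (\sum_(i <- s) F i) = \sum_(i <- s) x ⊗ F i.
Proof.
have tD : {morph @tpure k V W x : y y' / y + y'} by move=> y y'; apply: tpureDr.
exact: (big_morph _ tD (bilinear0r (@tpure_is_bilinear k V W) x)).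
Qed.

Lemma tlift_sum (U : lmodType k) (f : V -> W -> U) (fB : bilinear_map f)
    I (s : seq I) (x : I -> V) (y : I -> W) :
  tlift fB (\sum_(i <- s) x i ⊗ y i) = \sum_(i <- s) f (x i) (y i).
Proof.
rewrite [LHS](linear_sum (tlift fB)).
by apply: eq_bigr => i _; apply: tliftE.
Qed.

Lemma tmap_sum (f : {linear V -> V'}) (g : {linear W -> W'}) I (s : seq I)
    (x : I -> V) (y : I -> W) :
  tmap f g (\sum_(i <- s) x i ⊗ y i) = \sum_(i <- s) f (x i) ⊗ g (y i).
Proof. exact: tlift_sum. Qed.

Lemma tcontractl_sum (f : {linear V -> k^o}) I (s : seq I)
    (x : I -> V) (y : I -> W) :
  tcontractl f (\sum_(i <- s) x i ⊗ y i) = \sum_(i <- s) (f (x i) : k) *: y i.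
Proof. exact: tlift_sum. Qed.

Lemma tcontractr_sum (g : {linear W -> k^o}) I (s : seq I)
    (x : I -> V) (y : I -> W) :
  tcontractr g (\sum_(i <- s) x i ⊗ y i) = \sum_(i <- s) (g (y i) : k) *: x i.
Proof. exact: tlift_sum. Qed.

End TensorSums.

(** * Bilinearity of the product of a tensor product of algebras *)

Section TensorAlgebraTheory.
Variables (k : fieldType) (A B : algType k).
Implicit Types (t u : tensor A B) (a : k).

Lemma tmulZl t u a : (a *: t) * u = a *: (t * u).
Proof.
rewrite -[LHS]/(tmul _ _) /tmul tpureZl [tinterchange _]linearZ.
by rewrite [LHS]linearZ.
Qed.

Lemma tmulZr t u a : t * (a *: u) = a *: (t * u).
Proof.
rewrite -[LHS]/(tmul _ _) /tmul tpureZr [tinterchange _]linearZ.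
by rewrite [LHS]linearZ.
Qed.

Lemma tmul_linear t : linear (fun u => t * u).
Proof. by move=> a u v; rewrite mulrDr tmulZr. Qed.

End TensorAlgebraTheory.

(** * Sums over a decomposition of the comultiplication *)

Section Sweedler.
Variables (k : fieldType) (B : bialgType k).

(** An arbitrary decomposition of [comul x] into pure tensors, which lets
    Sweedler's [x_1] and [x_2] be written as the components of its entries. *)
Definition sweedler (x : B) : seq (B * B) := projT1 (cid (tensorE (comul x))).

Lemma comulE x : comul x = \sum_(p <- sweedler x) p.1 ⊗ p.2.
Proof. by rewrite /sweedler; case: cid. Qed.

Lemma sweedler_counitl x :
  \sum_(p <- sweedler x) (counit p.1 : k) *: p.2 = x.
Proof.
by rewrite -[RHS]counitl comulE tcontractl_sum.
Qed.

Lemma sweedler_counitr x :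
  \sum_(p <- sweedler x) (counit p.2 : k) *: p.1 = x.
Proof.
by rewrite -[RHS]counitr comulE tcontractr_sum.
Qed.

Section Coassoc.
Variables (U : lmodType k) (F : B -> B -> B -> U).
Hypotheses (F1 : forall b c, linear (fun a => F a b c))
  (F2 : forall a c, linear (fun b => F a b c))
  (F3 : forall a b, linear (F a b)).

Let F23 a : bilinear_map (F a). Proof. by split=> [c|b]; [apply: F2|apply: F3]. Qed.

Let G_bilinear : bilinear_map (fun a t => tlift (F23 a) t).
Proof.
split=> [t|a] z u v; last by rewrite linearP.
case: (tensorE t) => s ->; rewrite !tlift_sum scaler_sumr -big_split /=.
by apply: eq_bigr => p _; rewrite F1.
Qed.

(** Coassociativity for a trilinear expression [F x_1 x_2 x_3].  The two sides
    run over unrelated decompositions, so they agree only because [F] extends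
    to the triple tensor product. *)
Lemma sweedler_coassoc x :
  \sum_(p <- sweedler x) \sum_(q <- sweedler p.1) F q.1 q.2 p.2 =
  \sum_(p <- sweedler x) \sum_(q <- sweedler p.2) F p.1 q.1 q.2.
Proof.
have /(congr1 (tlift G_bilinear)) := comulA x.
rewrite comulE !tmap_sum => E.
apply: etrans (etrans _ E) _.
  rewrite (linear_sum (@tassoc k B B B)) (linear_sum (tlift G_bilinear)).
  apply: eq_bigr => p _; rewrite /= comulE tpure_suml.
  rewrite (linear_sum (@tassoc k B B B)) (linear_sum (tlift G_bilinear)).
  by apply: eq_bigr => q _; rewrite /= tassocE !tliftE.
rewrite tlift_sum; apply: eq_bigr => p _.
by rewrite /= comulE tlift_sum.
Qed.
End Coassoc.

(** * Convolution, in the algebra and in its opposite *)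

Definition opmul_fun (x y : B) : B := y * x.
Fact opmul_fun_bilinear : bilinear_map opmul_fun.
Proof.
split=> [y|x]; first exact: (amul_fun_is_bilinear _).2.
exact: (amul_fun_is_bilinear _).1.
Qed.
Definition opmul : tensor B B -> B := tlift opmul_fun_bilinear.
HB.instance Definition _ := GRing.Linear.on opmul.

Definition opconv (f g : {linear B -> B}) : B -> B := opmul \o tmap f g \o comul.
HB.instance Definition _ f g := GRing.Linear.on (opconv f g).

Implicit Types f g h S : {linear B -> B}.

Lemma convE f g x : conv f g x = \sum_(p <- sweedler x) f p.1 * g p.2.
Proof.
by rewrite /conv /= comulE tmap_sum [LHS]tlift_sum.
Qed.

Lemma opconvE f g x : opconv f g x = \sum_(p <- sweedler x) g p.2 * f p.1.
Proof.
by rewrite /opconv /= comulE tmap_sum [LHS]tlift_sum.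
Qed.

Lemma eq_conv f f' g g' : f =1 f' -> g =1 g' -> conv f g =1 conv f' g'.
Proof.
move=> ff' gg' x; rewrite !convE.
by apply: eq_bigr => p _; rewrite ff' gg'.
Qed.

Lemma convA f g h : conv (conv f g) h =1 conv f (conv g h).
Proof.
move=> x; rewrite !convE.
transitivity (\sum_(p <- sweedler x) \sum_(q <- sweedler p.1)
  f q.1 * g q.2 * h p.2).
  by apply: eq_bigr => p _; rewrite [X in X * _]convE mulr_suml.
rewrite (sweedler_coassoc (F := fun a b c => f a * g b * h c)).
- apply: eq_bigr => p _; rewrite [X in _ * X]convE mulr_sumr.
  by apply: eq_bigr => q _; rewrite mulrA.
- by move=> b c z u v; rewrite linearP !mulrDl -!scalerAl.
- by move=> a c z u v; rewrite linearP mulrDr mulrDl -scalerAr -scalerAl.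
- by move=> a b z u v; rewrite linearP mulrDr -scalerAr.
Qed.

Lemma conv1f f : conv (@conv1 k B) f =1 f.
Proof.
move=> x; rewrite convE -[in RHS](sweedler_counitl x) linear_sum.
by apply: eq_bigr => p _; rewrite linearZ /= /conv1 -scalerAl mul1r.
Qed.

Lemma opconvf1 f : opconv f (@conv1 k B) =1 f.
Proof.
move=> x; rewrite opconvE -[in RHS](sweedler_counitr x) linear_sum.
by apply: eq_bigr => p _; rewrite linearZ /= /conv1 -scalerAl mul1r.
Qed.

Lemma opconv1f f : opconv (@conv1 k B) f =1 f.
Proof.
move=> x; rewrite opconvE -[in RHS](sweedler_counitl x) linear_sum.
by apply: eq_bigr => p _; rewrite linearZ /= /conv1 -scalerAr mulr1.
Qed.

(** * Eliminating the antipode from a shift-invariant expression *)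

Section Pairing.
Variables (T : Type) (P : {linear B -> B} -> {linear B -> B} -> T)
  (shift : {linear B -> B} -> {linear B -> B}).
Hypotheses (P_ext : forall f f' g, f =1 f' -> P f g = P f' g)
  (P_shift : forall f g, P (conv f idfun) (shift g) = P f g).

Lemma pairing_iter m f g : P (conv f (convX idfun m)) (iter m shift g) = P f g.
Proof.
elim: m f g => [|m IHm] f g.
  rewrite -[RHS]P_shift -[LHS]P_shift; apply: P_ext => x.
  (* [f * u ε] and [f] have the same product with [Id], by the left unit law:
     [(f * u ε) * Id = f * (u ε * Id) = f * Id] *)
  apply: etrans (convA _ _ _ _) _; apply: eq_conv => // y; exact: conv1f.
rewrite iterSr -[RHS]P_shift -[RHS]IHm.
by apply: P_ext => x; symmetry; apply: convA.
Qed.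

(** Absorb [n + 1] factors [Id] to make [S * Id^(n+1) = Id^n] appear, then
    release [n] of them: one [shift] is left over. *)
Lemma pairing_left_antipode n S g : left_antipode n S ->
  P S g = P (@conv1 k B) (shift g).
Proof.
move=> SP; rewrite -(pairing_iter n.+1) iterSr -[RHS](pairing_iter n).
by apply: P_ext => x; rewrite [LHS]SP [RHS]conv1f.
Qed.
End Pairing.

(** * The quotient B ⊘ B *)

(** The submodule is only spanned by the [t * comul b] with [b] in the kernel of
    the counit; an arbitrary [b] is reduced to [b - counit b *: 1]. *)
Lemma oslash_comul (t : tensor B B) b :
  lquot_pi (@oslash_rel k B) (t * comul b)
    = (counit b : k) *: lquot_pi (@oslash_rel k B) t.
Proof.
rewrite -linearZ; apply/lquot_piP/lspan_gen.
exists t, (b - (counit b : k)%:A); split.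
  rewrite linearB linearZ /= counit_is_monoid_morphism.1.
  by rewrite [_ *: 1]mulr1 subrr.
rewrite linearB [comul _%:A]linearZ /= comul_is_monoid_morphism.1.
by rewrite mulrBr tmulZr mulr1.
Qed.

Definition oslash_pairing (t : tensor B B) (y : B) f g : oslash B :=
  lquot_pi (@oslash_rel k B) (t * tmap f g (comul y)).

Lemma oslash_pairingE t y f g : oslash_pairing t y f g =
  \sum_(p <- sweedler y) lquot_pi (@oslash_rel k B) (t * (f p.1 ⊗ g p.2)).
Proof.
by rewrite /oslash_pairing comulE tmap_sum mulr_sumr [LHS]linear_sum.
Qed.

(** The left side is the class of [t (f(y_1) y_2 ⊗ g(y_4) y_3)]: the shift puts
    [y_3] to the right of [g], so that it meets [y_2] to form [Δ(y_2)]. *)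
Lemma oslash_pairing_shift t y f g :
  oslash_pairing t y (conv f idfun) (opconv idfun g) = oslash_pairing t y f g.
Proof.
rewrite !oslash_pairingE.
pose pi : {linear tensor B B -> oslash B} := lquot_pi (@oslash_rel k B).
have piM (u : tensor B B) : linear (fun v : tensor B B => pi (u * v)).
  by move=> a v w; rewrite tmul_linear linearP.
transitivity (\sum_(p <- sweedler y) \sum_(q <- sweedler p.1)
   pi (t * ((f q.1 * q.2) ⊗ opconv idfun g p.2))).
  apply: eq_bigr => p _; rewrite /= convE tpure_suml mulr_sumr.
  by rewrite [LHS]linear_sum.
rewrite (sweedler_coassoc
  (F := fun a b c => pi (t * ((f a * b) ⊗ opconv idfun g c)))); first last.
- by move=> a b z u v; rewrite linearP tpurePr piM.
- by move=> a c z u v; rewrite mulrDr -scalerAr tpurePl piM.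
- by move=> b c z u v; rewrite linearP mulrDl -scalerAl tpurePl piM.
apply: eq_bigr => p _.
transitivity (\sum_(q <- sweedler p.2) \sum_(r <- sweedler q.2)
   pi (t * ((f p.1 * q.1) ⊗ (g r.2 * r.1)))).
  apply: eq_bigr => q _; rewrite /= opconvE tpure_sumr mulr_sumr.
  by rewrite [LHS]linear_sum.
(* regroup [y_2], [y_3] as the comultiplication of a single factor *)
rewrite -(sweedler_coassoc
  (F := fun a b c => pi (t * ((f p.1 * a) ⊗ (g c * b))))); first last.
- by move=> a b z u v; rewrite linearP mulrDl -scalerAl tpurePr piM.
- by move=> a c z u v; rewrite mulrDr -scalerAr tpurePr piM.
- by move=> b c z u v; rewrite mulrDr -scalerAr tpurePl piM.
transitivity (\sum_(q <- sweedler p.2)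
   (counit q.1 : k) *: pi (t * (f p.1 ⊗ g q.2))).
  apply: eq_bigr => q _; rewrite -oslash_comul comulE mulr_sumr [RHS]linear_sum.
  by apply: eq_bigr => r _; rewrite -mulrA tensorME.
rewrite -[in RHS](sweedler_counitl p.2) (linear_sum g) tpure_sumr.
rewrite mulr_sumr [RHS]linear_sum.
by apply: eq_bigr => q _; rewrite [g (_ *: _)]linearZ tpureZr tmulZr [RHS]linearZ.
Qed.

(** The factor [x] is what yields surjectivity of [iB]: every pure class
    [x ⊘ y] is the image of [x * S y]. *)
Lemma oslash_left_antipode n S x y : left_antipode n S ->
  (x * S y) ⊘ 1 = x ⊘ y.
Proof.
move=> SP.
have ext f f' g : f =1 f' ->
    oslash_pairing (x ⊗ 1) y f g = oslash_pairing (x ⊗ 1) y f' g.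
  move=> ff'; rewrite !oslash_pairingE.
  by apply: eq_bigr => p _; rewrite ff'.
have := pairing_left_antipode ext (@oslash_pairing_shift (x ⊗ 1) y)
  (@conv1 k B) SP.
rewrite /oslash_pairing.
have -> : tmap S (@conv1 k B) (comul y) = S y ⊗ 1.
  rewrite -[in RHS](sweedler_counitr y) comulE tmap_sum (linear_sum S) tpure_suml.
  by apply: eq_bigr => p _; rewrite [S (_ *: _)]linearZ tpureZl -tpureZr.
have -> : tmap (@conv1 k B) (opconv idfun (@conv1 k B)) (comul y) = 1 ⊗ y.
  rewrite -[in RHS](sweedler_counitl y) comulE tmap_sum tpure_sumr.
  by apply: eq_bigr => p _; rewrite /= opconvf1 tpureZl tpureZr.
by rewrite !tensorME !mulr1 mul1r.
Qed.

(** * Coinvariants *)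

Definition coinv_pairing_fun f g (x y : B) : tensor B B :=
  tmap idfun f (comul x) * (1 ⊗ g y).

Fact coinv_pairing_fun_bilinear f g : bilinear_map (coinv_pairing_fun f g).
Proof.
split=> [y|x] a u v; rewrite /coinv_pairing_fun.
  by rewrite [comul _]linearP [tmap _ _ _]linearP mulrDl tmulZl.
by rewrite [g _]linearP tpurePr tmul_linear.
Qed.
Definition coinv_pairing f g : tensor B B -> tensor B B :=
  tlift (coinv_pairing_fun_bilinear f g).
HB.instance Definition _ f g := GRing.Linear.on (coinv_pairing f g).

Lemma coinv_pairingE f g x y : coinv_pairing f g (x ⊗ y) =
  \sum_(p <- sweedler x) p.1 ⊗ (f p.2 * g y).
Proof.
rewrite /coinv_pairing tliftE /coinv_pairing_fun comulE tmap_sum mulr_suml.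
by apply: eq_bigr => p _; rewrite tensorME mulr1.
Qed.

Section Insert.
Variables f g : {linear B -> B}.

(** The map [(a ⊗ b) ⊗ c |-> a_1 ⊗ f(a_2) c g(b)].  Both sides of the
    coinvariance equation [diag_coaction t = t ⊗ 1] go through it: the third
    factor is inserted between [f] and [g], exactly where [x_3 y_2] stands in
    [x_1 ⊗ f(x_2) x_3 y_2 g(y_1)]. *)
Definition insert_pure (c a b : B) : tensor B B :=
  tmap idfun f (comul a) * (1 ⊗ (c * g b)).
Fact insert_pure_bilinear c : bilinear_map (insert_pure c).
Proof.
split=> [y|x] a u v; rewrite /insert_pure.
  by rewrite [comul _]linearP [tmap _ _ _]linearP mulrDl tmulZl.
by rewrite [g _]linearP mulrDr -scalerAr tpurePr tmul_linear.
Qed.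
Definition insert_fun (t : tensor B B) (c : B) := tlift (insert_pure_bilinear c) t.
Fact insert_fun_bilinear : bilinear_map insert_fun.
Proof.
split=> [c|t] a u v; rewrite /insert_fun ?linearP //.
case: (tensorE t) => s ->; rewrite !tlift_sum scaler_sumr -big_split /=.
apply: eq_bigr => p _; rewrite /insert_pure.
by rewrite mulrDl -scalerAl tpurePr tmul_linear.
Qed.
Definition insert := tlift insert_fun_bilinear.
HB.instance Definition _ := GRing.Linear.on insert.

Lemma insertE a b c : insert ((a ⊗ b) ⊗ c) =
   \sum_(p <- sweedler a) p.1 ⊗ (f p.2 * c * g b).
Proof.
rewrite /insert tliftE /insert_fun tliftE /insert_pure comulE tmap_sum mulr_suml.
by apply: eq_bigr => p _; rewrite tensorME mulr1 mulrA.
Qed.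

Lemma insert1 t : insert (t ⊗ 1) = coinv_pairing f g t.
Proof.
case: (tensorE t) => s ->; rewrite tpure_suml [LHS]linear_sum [RHS]linear_sum.
apply: eq_bigr => p _; rewrite /= insertE coinv_pairingE.
by apply: eq_bigr => q _; rewrite mulr1.
Qed.

Lemma insert_diag_coaction t : insert (diag_coaction t) =
  coinv_pairing (conv f idfun) (opconv g idfun) t.
Proof.
case: (tensorE t) => s ->; rewrite [diag_coaction _]linear_sum.
rewrite [LHS]linear_sum [RHS]linear_sum.
apply: eq_bigr => -[x y] _ /=; rewrite coinv_pairingE /diag_coaction /= tmapE.
transitivity (\sum_(p <- sweedler x) \sum_(q <- sweedler p.1)
   q.1 ⊗ (f q.2 * p.2 * opconv g idfun y)).
  rewrite comulE tpure_suml (linear_sum (@tinterchange k B B B B)).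
  rewrite (linear_sum (tmap _ _)) [LHS]linear_sum; apply: eq_bigr => p _ /=.
  rewrite [comul y]comulE tpure_sumr (linear_sum (@tinterchange k B B B B)).
  rewrite (linear_sum (tmap _ _)) [LHS]linear_sum /=.
  under eq_bigr => q _ do rewrite tinterchangeE tmapE /= amulE insertE.
  rewrite exchange_big /=; apply: eq_bigr => q _.
  rewrite opconvE mulr_sumr tpure_sumr; apply: eq_bigr => r _.
  by rewrite !mulrA.
rewrite (sweedler_coassoc (F := fun a b c => a ⊗ (f b * c * opconv g idfun y))).
- by apply: eq_bigr => p _; rewrite convE mulr_suml tpure_sumr.
- by move=> b c z u v; rewrite tpurePl.
- by move=> a c z u v; rewrite linearP !mulrDl -!scalerAl tpurePr.
- by move=> a b z u v; rewrite mulrDr mulrDl -scalerAr -scalerAl tpurePr.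
Qed.
End Insert.

(** The first tensor factor [x_1] kept aside in [coinv_pairing] is what makes
    this recover all of [t] from its image under [pB], and not just its
    contraction [counit x *: y]. *)
Lemma coinv_left_antipode n S t : left_antipode n S -> t \in coinv B ->
  t = tmap idfun S (comul (tcontractr counit t)).
Proof.
move=> SP /eqP tB.
have ext f f' g : f =1 f' -> coinv_pairing f g t = coinv_pairing f' g t.
  move=> ff'; case: (tensorE t) => s ->; rewrite [LHS]linear_sum [RHS]linear_sum.
  apply: eq_bigr => p _; rewrite /= !coinv_pairingE.
  by apply: eq_bigr => q _; rewrite ff'.
have shiftP f g : coinv_pairing (conv f idfun) (opconv g idfun) t =
    coinv_pairing f g t.
  by rewrite -insert_diag_coaction tB insert1.
have := pairing_left_antipode (P := fun f g => coinv_pairing f g t)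
  (shift := fun g => opconv g idfun) ext shiftP (@conv1 k B) SP.
case: (tensorE t) => s -> E; symmetry; apply: etrans (etrans _ E) _.
  rewrite tcontractr_sum (linear_sum comul) (linear_sum (tmap _ _)).
  rewrite [RHS]linear_sum; apply: eq_bigr => p _.
  rewrite [comul _]linearZ [LHS]linearZ /= coinv_pairingE comulE tmap_sum.
  rewrite scaler_sumr; apply: eq_bigr => q _.
  by rewrite /conv1 -tpureZr -scalerAr mulr1.
rewrite [LHS]linear_sum; apply: eq_bigr => p _.
rewrite /= coinv_pairingE -[in RHS](sweedler_counitr p.1) tpure_suml.
apply: eq_bigr => q _.
by rewrite /= opconv1f /conv1 -scalerAl mul1r tpureZr -tpureZl.
Qed.

Lemma coinv_left_antipode_counit n S t : left_antipode n S -> t \in coinv B ->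
  S (tcontractr counit t) = tcontractl counit t.
Proof.
move=> SP tB; rewrite [in RHS](coinv_left_antipode SP tB).
rewrite -{1}(counitl (tcontractr counit t)) comulE tmap_sum.
rewrite !tcontractl_sum (linear_sum S).
by apply: eq_bigr => p _; rewrite [LHS]linearZ.
Qed.

(** * Finite-dimensional bialgebras *)

Definition convX_comb m (c : nat -> k) (x : B) : B :=
  \sum_(j < m) c j *: convX idfun j x.
Fact convX_comb_linear m c : linear (convX_comb m c).
Proof.
move=> a u v; rewrite /convX_comb scaler_sumr -big_split.
by apply: eq_bigr => j _; rewrite linearP scalerDr !scalerA mulrC.
Qed.
HB.instance Definition _ m c :=
  GRing.isLinear.Build k B B *:%R (convX_comb m c) (convX_comb_linear m c).

Lemma convXD i j :
  conv (convX (idfun : {linear B -> B}) i) (convX idfun j)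
    =1 convX idfun (i + j).
Proof.
elim: i => [|i IHi] x; first exact: conv1f.
by rewrite convA; apply: eq_conv.
Qed.

Lemma conv_comb m c n : conv (convX_comb m c) (convX idfun n) =1
  fun x => \sum_(j < m) c j *: convX idfun (j + n) x.
Proof.
move=> x; rewrite convE.
under eq_bigr => p _ do rewrite mulr_suml.
rewrite exchange_big; apply: eq_bigr => j _.
rewrite -convXD convE scaler_sumr.
by apply: eq_bigr => p _; rewrite scalerAl.
Qed.

(** If [n] is the least index with [c n != 0], then
    [Id^n = - (c n)^-1 \sum_(j > n) c j Id^j], and every power [Id^j] on the
    right contains the factor [Id^(n+1)]. *)
Lemma left_antipode_of_relation m (c : nat -> k) :
  (forall x : B, \sum_(j < m) c j *: convX idfun j x = 0) ->
  (exists2 j, (j < m)%N & c j != 0) ->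
  exists n, exists S : {linear B -> B}, left_antipode n S.
Proof.
move=> rel ex.
have ex' : exists j, (j < m)%N && (c j != 0).
  by case: ex => j jm cj; exists j; rewrite jm.
case: (ex_minnP ex') => n /andP[nm cn] nmin.
exists n, (convX_comb (m - n.+1) (fun j => - (c n)^-1 * c (j + n.+1)%N)) => x.
rewrite conv_comb; move: (rel x).
rewrite -(big_mkord xpredT (fun j => c j *: convX idfun j x)).
rewrite (big_cat_nat (n := n)) //=; last exact: ltnW.
rewrite big_nat big1 ?add0r; last first.
  move=> j /andP[_ jn]; case: (eqVneq (c j) 0) => [->|cj]; first by rewrite scale0r.
  by have := nmin j; rewrite cj (ltn_trans jn nm) leqNgt jn => /(_ isT).
rewrite big_ltn // => /eqP; rewrite addr_eq0 => /eqP E.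
transitivity (- (c n)^-1 *: \sum_(n.+1 <= j < m) c j *: convX idfun j x).
  rewrite scaler_sumr -[X in \sum_(X <= _ < _) _]add0n big_addn big_mkord.
  by apply: eq_bigr => j _; rewrite scalerA.
by rewrite scaleNr -scalerN -E scalerA mulVf ?scale1r.
Qed.

(** The powers [Id^0, ..., Id^(d^2)], as matrices [M j] in coordinates, are
    [d^2 + 1] vectors in a space of dimension [d^2], so the matrix [A] having
    them as rows has a nonzero left kernel. *)
Lemma finite_dim_relation : finite_dim B ->
  exists m (c : nat -> k),
    (forall x : B, \sum_(j < m) c j *: convX idfun j x = 0) /\
    (exists2 j, (j < m)%N & c j != 0).
Proof.
case=> d [F [G FK GK]].
pose M j : 'M[k]_d := \matrix_i F (convX idfun j (G (delta_mx 0 i))).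
pose A := \matrix_(j < (d * d).+1) mxvec (M j).
have /rowV0Pn[v /sub_kermxP vA v0] : kermx A != 0.
  rewrite kermx_eq0 /row_free neq_ltn; apply/orP; left.
  by rewrite ltnS rank_leq_col.
have GL : linear G.
  by move=> a u w; apply: (can_inj FK); rewrite linearP !GK.
exists (d * d).+1, (fun j => v 0 (inord j)); split; last first.
  case/rV0Pn: v0 => j vj; exists j => //.
  by rewrite inord_val.
move=> x; apply: (can_inj FK).
have vM : \sum_(j < (d * d).+1) v 0 j *: M j = 0.
  apply: (can_inj mxvecK); rewrite linear_sum linear0 -[RHS]vA mulmx_sum_row.
  by apply: eq_bigr => j _; rewrite linearZ rowK.
have FE j y : F (convX idfun j (G y)) = y *m M j.
  pose GL' : {linear 'rV[k]_d -> B} :=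
    HB.pack G (GRing.isLinear.Build k _ _ _ G GL).
  rewrite {1}[y]row_sum_delta -[G _]/(GL' _) !linear_sum mulmx_sum_row.
  by apply: eq_bigr => i _; rewrite !linearZ rowK.
rewrite [RHS]linear0 linear_sum.
transitivity (F x *m \sum_(j < (d * d).+1) v 0 j *: M j); last by rewrite vM mulmx0.
rewrite mulmx_sumr; apply: eq_bigr => j _.
by rewrite linearZ inord_val -[in LHS](FK x) FE -scalemxAr.
Qed.

Lemma finite_dim_left_Hopf : finite_dim B -> exists n, left_Hopf B n.
Proof.
move=> /finite_dim_relation[m [c [rel ex]]].
have [n0 n0P] := left_antipode_of_relation rel ex.
have ex' : exists n, `[< exists S : {linear B -> B}, left_antipode n S >].
  by exists n0; apply/asboolP.
case: (ex_minnP ex') => n /asboolP nS nmin.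
by exists n; split=> // i /asboolP; apply: nmin.
Qed.

End Sweedler.

Theorem proposition2p29 (k : fieldType) :
  (forall (B : bialgType k) (n : nat) (S : {linear B -> B}),
     left_Hopf B n -> left_antipode n S ->
     [/\ forall y : B, S y ⊘ 1 = 1 ⊘ y,
         forall z : oslash B, exists b : B, iB b = z,
         forall (m : nat) (x y : 'I_m -> B),
           \sum_(i < m) x i ⊗ y i \in coinv B ->
           \sum_(i < m) (counit (y i) : k) *: S (x i)
             = \sum_(i < m) (counit (x i) : k) *: y i
       & injective (pB : coinv_sub B -> B)]) /\
  (forall B : bialgType k, finite_dim B -> exists n : nat, left_Hopf B n).
Proof.
split=> [B n S _ SP|]; last exact: finite_dim_left_Hopf.
split.
- by move=> y; rewrite -(oslash_left_antipode 1 y SP) mul1r.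
- move=> z; case: (lquot_piE z) => t ->; case: (tensorE t) => s ->.
  exists (\sum_(p <- s) p.1 * S p.2).
  rewrite /iB /oslash_pure tpure_suml [LHS]linear_sum [RHS]linear_sum.
  by apply: eq_bigr => p _; apply: (oslash_left_antipode p.1 p.2 SP).
- move=> m x y /(coinv_left_antipode_counit SP).
  rewrite tcontractl_sum tcontractr_sum (linear_sum S) => <-.
  by apply: eq_bigr => i _; rewrite [RHS]linearZ.
- move=> t u tu; apply: val_inj.
  rewrite (coinv_left_antipode SP (valP t)) (coinv_left_antipode SP (valP u)).
  by rewrite -/(pB t) -/(pB u) tu.
Qed.
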